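(* For a metric space $(X,d)$, the following statements are equivalent: (1) $X$ is ultrametric. (2) $X$ has infinite generalized roundness, i.e. $\mathfrak{q}(X,d) = \infty$. (3) $X$ has infinite roundness, i.e. $\mathfrak{p}(X,d) = \infty$.
   Context: A metric space $(X,d)$ is ultrametric if $d(x,y) \le \max\{d(x,z), d(y,z)\}$ for all $x,y,z \in X$. Roundness: a real number $p \ge 1$ is a roundness exponent of $(X,d)$ if for all quadruples of (not necessarily distinct) points $x_{00}, x_{01}, x_{11}, x_{10} \in X$ we have $d(x_{00},x_{11})^p + d(x_{01},x_{10})^p \le d(x_{00},x_{01})^p + d(x_{01},x_{11})^p + d(x_{11},x_{10})^p + d(x_{10},x_{00})^p$. The roundness $\mathfrak{p}(X,d)$ is the supremum (in $[1,\infty]$) of the set of all roundness exponents of $(X,d)$. Generalized roundness: a real number $p \ge 0$ is a generalized roundness exponent of $(X,d)$ if for all integers $n > 0$ and all choices of (not necessarily distinct) points $a_1, \ldots, a_n, b_1, \ldots, b_n \in X$ we have $\sum_{1 \le k < l \le n} \{ d(a_k,a_l)^p + d(b_k,b_l)^p \} \le \sum_{1 \le j,i \le n} d(a_j,b_i)^p$. The generalized roundness $\mathfrak{q}(X,d)$ is the supremum (in $[0,\infty]$) of the set of all generalized roundness exponents of $(X,d)$. For $p = 0$ the convention $0^0 = 0$ is used for distances. *)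

(* Defs.v *)
From HB Require Import structures.
From mathcomp Require Import all_boot all_order all_algebra.
From mathcomp Require Import all_classical all_reals all_analysis.

Set Implicit Arguments.
Unset Strict Implicit.
Unset Printing Implicit Defensive.

Import Order.TTheory GRing.Theory Num.Theory.

Local Open Scope classical_set_scope.
Local Open Scope ring_scope.

Definition ultrametric (R : realType) (X : metricType R) : Prop :=
  forall x y z : X, mdist x y <= Num.max (mdist x z) (mdist y z).

Definition roundness_exponents (R : realType) (X : metricType R) : set R :=
  [set p | 1 <= p /\
    forall x00 x01 x11 x10 : X,
      mdist x00 x11 `^ p + mdist x01 x10 `^ p <=
      mdist x00 x01 `^ p + mdist x01 x11 `^ p +
      mdist x11 x10 `^ p + mdist x10 x00 `^ p].

(* 1 is a roundness exponent by the triangle inequality, so the set is never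
   empty and this supremum lies in [1, +oo]. *)
Definition roundness (R : realType) (X : metricType R) : \bar R :=
  ereal_sup [set p%:E | p in roundness_exponents X].

(* powR has 0 `^ 0 = 1, whereas the convention 0 ^ 0 = 0 is needed here;
   for p != 0 this is mdist x y `^ p. *)
Definition mdist_pow (R : realType) (X : metricType R) (p : R) (x y : X) : R :=
  if mdist x y == 0 then 0 else mdist x y `^ p.

Definition generalized_roundness_exponents (R : realType) (X : metricType R) :
    set R :=
  [set p | 0 <= p /\
    forall (n : nat) (a b : 'I_n -> X), (0 < n)%N ->
      \sum_(k < n) \sum_(l < n | (k < l)%N)
          (mdist_pow p (a k) (a l) + mdist_pow p (b k) (b l)) <=
      \sum_(j < n) \sum_(i < n) mdist_pow p (a j) (b i)].

(* 0 is a generalized roundness exponent (under 0 ^ 0 = 0), so the set is never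
   empty and this supremum lies in [0, +oo]. *)
Definition generalized_roundness (R : realType) (X : metricType R) : \bar R :=
  ereal_sup [set p%:E | p in generalized_roundness_exponents X].

(* Main.v *)
Require Import Defs.
From mathcomp Require Import all_boot all_order all_algebra.
From mathcomp Require Import all_classical all_reals all_analysis.
From mathcomp Require Import ring lra.

Set Implicit Arguments.
Unset Strict Implicit.
Unset Printing Implicit Defensive.

Import Order.TTheory GRing.Theory Num.Theory.

Local Open Scope classical_set_scope.
Local Open Scope ring_scope.

(** The cycle is (1) => (2) => (3) => (1).  A supremum of a set of reals is
    infinite exactly when the set is unbounded ([ereal_sup_EFin_pinfty]), so
    only large exponents matter throughout.

    (1) => (2).  In an ultrametric space every [p >= 0] is a generalized
    roundness exponent, because any ultrametric kernel [delta], here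
    [delta = d ^ p], is of negative type:
    [\sum_i \sum_j w i * w j * delta i j <= 0] whenever the weights sum to
    zero.  Weights 1 on the [a_k] and -1 on the [b_k] then give the required
    inequality.  Negative type holds because [delta] is a nonnegative
    combination of 0/1-valued ultrametrics: if [m] is the least nonzero value of [delta], then
    [delta = max (delta - m) 0 + m * (delta != 0)], the first summand is again
    an ultrametric kernel, now with more zeros, and one concludes by induction
    ([ultra_kernel_negative_type]).  For the 0/1-valued one, [delta = 0] is an
    equivalence relation, so that the quadratic form is [(\sum_i w i) ^ 2 = 0]
    minus the sum, over the equivalence classes, of the squared weight of the
    class ([sum_discrete_ultra_kernel_le0]).

    (2) => (3).  For [n = 2] and [p >= 1], the generalized roundness inequality
    is the roundness inequality, with the diagonals as the pairs
    [(a_1, a_2)] and [(b_1, b_2)].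

    (3) => (1).  The quadruple [x, z, y, z] gives
    [d(x,y)^p <= 2 * d(x,z)^p + 2 * d(y,z)^p <= 4 * m^p], where [m] is the
    maximum of [d(x,z)] and [d(y,z)].  If [d(x,y) > m], this fails as soon as
    [p] is large ([unbounded_roundness_ultrametric]). *)

(** * Ultrametric kernels are of negative type *)

(** The form is the sum over [c] of the squared weight of the fiber of [r]
    over [c]. *)
Lemma sum_same_fiber_ge0 (R : realDomainType) (I J : finType) (r : I -> J)
    (w : I -> R) :
  0 <= \sum_i \sum_j w i * w j * (r i == r j)%:R.
Proof.
suff -> : \sum_i \sum_j w i * w j * (r i == r j)%:R =
    \sum_c (\sum_i w i * (r i == c)%:R) ^+ 2.
  by apply: sumr_ge0 => c _; exact: sqr_ge0.
under [RHS]eq_bigr do rewrite expr2 mulr_suml.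
rewrite [RHS]exchange_big; apply: eq_bigr => i _ /=.
under [RHS]eq_bigr do rewrite mulr_sumr.
rewrite [RHS]exchange_big; apply: eq_bigr => j _ /=.
rewrite (bigD1 (r i)) //= eqxx big1 ?addr0 => [|c /negbTE cri].
  by rewrite mulr1 [r j == _]eq_sym mulrA.
by rewrite [r i == _]eq_sym cri mulr0 mul0r.
Qed.

(** Symmetry and nonnegativity are consequences, see [ultra_kernel_sym] and
    [ultra_kernel_ge0]; distinct points may be at distance zero, which is what
    lets the induction below collapse the smallest distances. *)
Definition ultra_kernel (R : realDomainType) (T : Type) (delta : T -> T -> R) :
    Prop :=
  (forall x, delta x x = 0) /\
  (forall x y z, delta x y <= Num.max (delta x z) (delta y z)).

Section UltrametricKernel.
Variable R : realDomainType.

Section AnyType.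
Variables (T : Type) (delta : T -> T -> R).
Hypothesis dK : ultra_kernel delta.

Lemma ultra_kernel_ge0 x y : 0 <= delta x y.
Proof. by have [d0 dU] := dK; have := dU x x y; rewrite d0 maxxx. Qed.

Lemma ultra_kernel_sym x y : delta x y = delta y x.
Proof.
have [d0 dU] := dK; apply/eqP; rewrite eq_le.
have := dU x y x; have := dU y x y.
by rewrite !d0 !max_r ?ultra_kernel_ge0 // => -> ->.
Qed.

Lemma ultra_kernel_monotone (f : R -> R) :
    f 0 = 0 -> {in Num.nneg &, {homo f : s t / s <= t}} ->
  ultra_kernel (fun x y => f (delta x y)).
Proof.
move=> f0 fle; have [d0 dU] := dK; split=> [x|x y z]; first by rewrite d0.
have dn t u : delta t u \in Num.nneg by rewrite nnegrE ultra_kernel_ge0.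
rewrite le_max; have := dU x y z.
by rewrite le_max => /orP[] /fle -> //; rewrite orbT.
Qed.

End AnyType.

(** The 0/1-valued case: as [delta != 0] is [1] minus the indicator of an
    equivalence relation, the form is [(\sum_i w i) ^ 2] minus a sum of
    squares. *)
Lemma sum_discrete_ultra_kernel_le0 (I : finType) (delta : I -> I -> R)
    (w : I -> R) :
  ultra_kernel delta -> \sum_i w i = 0 ->
  \sum_i \sum_j w i * w j * (delta i j != 0)%:R <= 0.
Proof.
move=> dK w0; have [d0 dU] := dK.
have d_ge0 := ultra_kernel_ge0 dK; have dC := ultra_kernel_sym dK.
(* [r i] is the class of [i] at distance zero. *)
pose r i := [set j | delta i j == 0]%SET.
have rE i j : (r i == r j) = (delta i j == 0).
  apply/eqP/eqP => [rij|dij].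
    have : i \in r j by rewrite -rij inE d0.
    by rewrite inE dC => /eqP.
  apply/setP => k; rewrite !inE.
  apply/eqP/eqP => dk; apply/eqP; rewrite eq_le d_ge0 andbT.
    by have := dU j k i; rewrite (dC j i) dij (dC k) dk maxxx.
  by have := dU i k j; rewrite dij (dC k) dk maxxx.
have -> : \sum_i \sum_j w i * w j * (delta i j != 0)%:R =
    (\sum_i w i) * (\sum_i w i) - \sum_i \sum_j w i * w j * (r i == r j)%:R.
  rewrite mulr_suml -sumrB; apply: eq_bigr => i _.
  rewrite mulr_sumr -sumrB; apply: eq_bigr => j _.
  by rewrite rE; case: (delta i j == 0) => /=; ring.
by rewrite w0 mul0r add0r oppr_le0 sum_same_fiber_ge0.
Qed.

(** Induction on the number of pairs at nonzero distance: subtracting the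
    least nonzero distance from all nonzero ones keeps the kernel ultrametric,
    since this applies a monotone function to it, and the difference is a
    multiple of a 0/1-valued ultrametric. *)
Lemma ultra_kernel_negative_type (I : finType) (delta : I -> I -> R)
    (w : I -> R) :
  ultra_kernel delta -> \sum_i w i = 0 ->
  \sum_i \sum_j w i * w j * delta i j <= 0.
Proof.
move=> + w0; have [n] := ubnP #|[pred p : I * I | delta p.1 p.2 != 0]|.
elim: n delta => // n IHn delta le_n dK.
have d_ge0 := ultra_kernel_ge0 dK.
have [[i0 j0] /= d0_neq0|d_eq0] :=
  pickP [pred p : I * I | delta p.1 p.2 != 0]; last first.
  rewrite big1 // => i _; rewrite big1 // => j _.
  by move/(_ (i, j)): d_eq0 => /= /negbFE/eqP ->; rewrite mulr0.
have [[i1 j1] /= d1_neq0 d1_min] := @arg_minP _ R (I * I)%type (i0, j0)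
  [pred p : I * I | delta p.1 p.2 != 0] (fun p => delta p.1 p.2) d0_neq0.
set m := delta i1 j1 in d1_neq0 d1_min.
pose delta' i j := Num.max (delta i j - m) 0.
have deltaE i j : delta i j = delta' i j + m * (delta i j != 0)%:R.
  rewrite /delta'; have [->|dij] := eqVneq (delta i j) 0.
    by rewrite mulr0 addr0 sub0r max_r // oppr_le0 d_ge0.
  by rewrite max_l ?subr_ge0 ?(d1_min (i, j)) // mulr1 subrK.
under eq_bigr do under eq_bigr do rewrite deltaE mulrDr mulrCA.
under eq_bigr do rewrite big_split /= -mulr_sumr.
rewrite big_split /= -mulr_sumr -oppr_ge0 opprD.
rewrite addr_ge0 ?oppr_ge0 //; last first.
  by rewrite mulr_ge0_le0 ?d_ge0 // sum_discrete_ultra_kernel_le0.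
apply: IHn.
  rewrite -ltnS; apply: leq_trans le_n; rewrite ltnS; apply: proper_card.
  apply/properP; split.
    apply/fintype.subsetP => -[i j]; rewrite !inE /= /delta'.
    by apply: contraNneq => ->; rewrite sub0r max_r // oppr_le0 d_ge0.
  exists (i1, j1); first by rewrite inE.
  by rewrite inE /= negbK /delta' -/m subrr maxxx.
apply: (ultra_kernel_monotone dK (f := fun t => Num.max (t - m) 0)).
  by rewrite sub0r max_r // oppr_le0 d_ge0.
by move=> x y _ _ xy; rewrite ge_max !le_max lerD2r xy lexx orbT.
Qed.

Lemma sum_sym_diag0 (n : nat) (f : 'I_n -> 'I_n -> R) :
  (forall i, f i i = 0) -> (forall i j, f i j = f j i) ->
  \sum_i \sum_j f i j = 2 * \sum_(i < n) \sum_(j < n | (i < j)%N) f i j.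
Proof.
move=> f0 fC; have -> : \sum_i \sum_j f i j =
    \sum_(i < n) \sum_(j < n | (i < j)%N) f i j +
    \sum_(i < n) \sum_(j < n | (j < i)%N) f i j.
  rewrite -big_split; apply: eq_bigr => i _ /=.
  rewrite [X in X + _]big_mkcond [X in _ + X]big_mkcond -big_split /=.
  apply: eq_bigr => j _; case: ltngtP => [||/val_inj ->].
  - by rewrite addr0.
  - by rewrite add0r.
  - by rewrite f0 addr0.
rewrite [X in _ + X](exchange_big_dep xpredT) //= mulr_natl mulr2n.
by congr (_ + _); apply: eq_bigr => i _; apply: eq_bigr => j _; rewrite fC.
Qed.

(** Negative type for the weights 1 on the [a k] and -1 on the [b k]. *)
Lemma ultra_kernel_generalized_roundness (T : Type) (delta : T -> T -> R)
    (n : nat) (a b : 'I_n -> T) :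
  ultra_kernel delta ->
  \sum_(k < n) \sum_(l < n | (k < l)%N) (delta (a k) (a l) + delta (b k) (b l))
    <= \sum_j \sum_i delta (a j) (b i).
Proof.
move=> dK; have [d0 dU] := dK; have dC := ultra_kernel_sym dK.
pose x (s : 'I_n + 'I_n) := match s with inl i => a i | inr i => b i end.
pose w (s : 'I_n + 'I_n) : R := match s with inl _ => 1 | inr _ => -1 end.
have w0 : \sum_s w s = 0 by rewrite big_sumType /= sumrN subrr.
have xK : ultra_kernel (fun s t => delta (x s) (x t)).
  by split=> [s|s t u]; [exact: d0 | exact: dU].
have := ultra_kernel_negative_type xK w0.
have -> : \sum_s \sum_t w s * w t * delta (x s) (x t) =
    \sum_j \sum_i delta (a j) (a i) + \sum_j \sum_i delta (b j) (b i) -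
    2 * \sum_j \sum_i delta (a j) (b i).
  rewrite big_sumType /=.
  under eq_bigr do rewrite big_sumType /=.
  under [X in _ + X = _]eq_bigr do rewrite big_sumType /=.
  rewrite !big_split /=.
  under eq_bigr do under eq_bigr do rewrite mulr1 mul1r.
  under [X in _ + X + _ = _]eq_bigr do under eq_bigr do rewrite mul1r mulN1r.
  under [X in _ + (X + _) = _]eq_bigr do
    under eq_bigr do rewrite mulr1 mulN1r dC.
  under [X in _ + X + _ = _]eq_bigr do rewrite sumrN.
  under [X in _ + (X + _) = _]eq_bigr do rewrite sumrN.
  under [X in _ + (_ + X) = _]eq_bigr do under eq_bigr do rewrite mulrNN !mul1r.
  by rewrite !sumrN [X in _ + (- X + _) = _]exchange_big /=; ring.
rewrite (sum_sym_diag0 (f := fun i j => delta (a i) (a j))) //.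
rewrite (sum_sym_diag0 (f := fun i j => delta (b i) (b j))) //.
under [X in _ -> X <= _]eq_bigr do rewrite big_split /=.
rewrite big_split /=; lra.
Qed.

End UltrametricKernel.

(** * Roundness exponents of metric spaces *)

Section Roundness.
Variables (R : realType) (X : metricType R).

Lemma mdist_pow_neq0 p (x y : X) : p != 0 ->
  mdist_pow p x y = mdist x y `^ p.
Proof. by move=> p0; rewrite /mdist_pow; case: eqP => // ->; rewrite powR0. Qed.

Lemma ultra_kernel_mdist_pow p :
  ultrametric X -> 0 <= p -> ultra_kernel (@mdist_pow R X p).
Proof.
move=> XU p0.
have dK : ultra_kernel (@mdist R X).
  by split=> [x|x y z]; [exact: mdistxx | exact: XU].
apply: (ultra_kernel_monotone dK (f := fun t => if t == 0 then 0 else t `^ p)).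
  by rewrite eqxx.
move=> s t; rewrite !nnegrE => s0 t0 st.
have [_|sn0] := eqVneq s 0; first by case: ifP => // _; exact: powR_ge0.
rewrite gt_eqF ?(lt_le_trans _ st) ?lt_neqAle 1?eq_sym ?sn0 //.
exact: ge0_ler_powR.
Qed.

Lemma ultrametric_generalized_roundness_exponent p :
  ultrametric X -> 0 <= p -> generalized_roundness_exponents X p.
Proof.
move=> XU p0; split=> // n a b _.
exact/ultra_kernel_generalized_roundness/ultra_kernel_mdist_pow.
Qed.

(** The diagonals [(x00, x11)] and [(x01, x10)] serve as the families [a] and
    [b]; for [p >= 1] the two conventions for the power zero of the distance
    zero do not interfere. *)
Lemma generalized_roundness_exponent_roundness p :
  1 <= p -> generalized_roundness_exponents X p -> roundness_exponents X p.
Proof.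
move=> p1 [_ gr]; split=> // x00 x01 x11 x10.
pose a (i : 'I_2) := if i == 0 then x00 else x11.
pose b (i : 'I_2) := if i == 0 then x01 else x10.
have := gr 2 a b isT.
under eq_bigr do rewrite big_mkcond !big_ord_recl big_ord0 /=.
rewrite !big_ord_recl !big_ord0 /= /a /b /=.
rewrite !mdist_pow_neq0 ?gt_eqF ?(lt_le_trans ltr01) //.
rewrite (metric_sym x11 x01) (metric_sym x00 x10); lra.
Qed.

Lemma ereal_sup_EFin_pinfty (S : set R) :
  ereal_sup [set p%:E | p in S] = +oo%E <->
  forall M : R, exists2 p, S p & M < p.
Proof.
split=> [Soo M|S_unbounded].
  have : (M%:E < ereal_sup [set p%:E | p in S])%E by rewrite Soo ltry.
  by move=> /ereal_sup_gt[_ [p Sp <-]]; rewrite lte_fin => Mp; exists p.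
apply: hasNub_ereal_sup; last by have [p Sp _] := S_unbounded 0; exists p.
by apply/has_ubPn => M; have [p] := S_unbounded M; exists p.
Qed.

(** The quadruple [x, z, y, z], whose second diagonal is degenerate, bounds
    [d(x,y)^p] by [4 * m^p], and [(d(x,y) / m)^p] is unbounded in [p] when
    [d(x,y) > m]. *)
Lemma unbounded_roundness_ultrametric :
  (forall M : R, exists2 p, roundness_exponents X p & M < p) -> ultrametric X.
Proof.
move=> unb x y z; rewrite leNgt; apply/negP => ltd.
set m := Num.max _ _ in ltd; set d := mdist x y in ltd.
have m0 : 0 <= m by rewrite /m le_max mdist_ge0.
have d0 : 0 < d by exact: le_lt_trans ltd.
have key p : roundness_exponents X p -> d `^ p <= 4 * m `^ p.
  move=> [p1 /(_ x z y z)]; have p0 : 0 <= p by exact: le_trans p1.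
  rewrite mdistxx powR0 ?gt_eqF ?(lt_le_trans ltr01) // addr0 -/d.
  rewrite (metric_sym z y) (metric_sym z x).
  have lexz : mdist x z `^ p <= m `^ p.
    by apply: ge0_ler_powR; rewrite ?nnegrE ?mdist_ge0 // /m le_max lexx.
  have leyz : mdist y z `^ p <= m `^ p.
    by apply: ge0_ler_powR; rewrite ?nnegrE ?mdist_ge0 // /m le_max lexx orbT.
  lra.
(* For [m = 0] the quotient [d / m] is meaningless. *)
have [m_eq0|m_neq0] := eqVneq m 0.
  have [p Ep _] := unb 0; have := key p Ep.
  rewrite m_eq0 powR0 ?mulr0 ?leNgt ?powR_gt0 //.
  by rewrite gt_eqF // (lt_le_trans ltr01) //; case: Ep.
have m_gt0 : 0 < m by rewrite lt_neqAle eq_sym m_neq0.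
have r_gt1 : 1 < d / m by rewrite ltr_pdivlMr // mul1r.
have lnr : 0 < ln (d / m) by exact: ln_gt0.
(* [r^p = exp (p * ln r) >= 1 + p * ln r], which exceeds 4 for
   [p > 3 / ln r]. *)
have [p Ep pbig] := unb (3 / ln (d / m)); have := key p Ep.
rewrite -[d in d `^ p](divfK m_neq0) powRM ?divr_ge0 // ?(ltW d0) //.
rewrite ler_pM2r ?powR_gt0 // leNgt => /negP; apply.
rewrite /powR gt_eqF ?divr_gt0 //; apply: lt_le_trans (expR_ge1Dx _).
by rewrite ltr_pdivrMr // in pbig; lra.
Qed.

End Roundness.

Theorem theorem5p1 (R : realType) (X : metricType R) :
  [<-> ultrametric X;
       generalized_roundness X = +oo%E;
       roundness X = +oo%E].
Proof.
tfae.
- move=> XU; apply/ereal_sup_EFin_pinfty => M; exists (Num.max 0 M + 1).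
    apply: ultrametric_generalized_roundness_exponent => //.
    by rewrite addr_ge0 // le_max lexx.
  by rewrite (@le_lt_trans _ _ (Num.max 0 M)) ?ltrDl // le_max lexx orbT.
- move=> /ereal_sup_EFin_pinfty unb; apply/ereal_sup_EFin_pinfty => M.
  have [p Ep] := unb (Num.max 1 M); rewrite gt_max => /andP[p1 Mp].
  exists p => //; apply: generalized_roundness_exponent_roundness => //.
  exact: ltW.
- by move=> /ereal_sup_EFin_pinfty; exact: unbounded_roundness_ultrametric.
Qed.
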